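(* Let $R$ be a commutative ring with identity and let $\{M_i\}_{i\in I}$ be a family of coprimely structured $R$-modules. Assume that $\text{Ann}(m_i)+\text{Ann}(m_j)=R$ for all $i,j\in I$ with $i\neq j$ and all $m_i\in M_i$, $m_j\in M_j$. Then the $R$-module $M=\bigoplus_{i\in I}M_i$ is coprimely structured.
   Context: All modules are unital. A prime submodule of an $R$-module $M$ is a proper submodule $P$ such that $rm\in P$ with $r\in R$, $m\in M$ implies $m\in P$ or $rM\subseteq P$. A prime submodule $P$ of $M$ is called coprimely structured if for every family $\{N_\lambda\}_{\lambda\in\Lambda}$ of submodules of $M$ with $N_\lambda+P=M$ for all $\lambda\in\Lambda$, one has $\bigcap_{\lambda\in\Lambda}N_\lambda\not\subseteq P$. An $R$-module is called coprimely structured if each of its prime submodules is coprimely structured. For an element $m$ of an $R$-module, $\text{Ann}(m)=\{r\in R: rm=0\}$. *)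

(* Defs.v *)
From HB Require Import structures.
From mathcomp Require Import all_boot all_algebra all_classical.
Set Implicit Arguments.
Unset Strict Implicit.
Unset Printing Implicit Defensive.
Import GRing.Theory.
Local Open Scope classical_set_scope.
Local Open Scope ring_scope.

(* Rings are taken in comPzRingType, so that the zero ring is allowed. *)

Definition setadd (V : nmodType) (A B : set V) : set V :=
  [set a + b | a in A & b in B].

Section Modules.
Variables (R : comPzRingType) (M : lmodType R).

Definition submodule (N : set M) : Prop := GRing.submod_closed [in N].

Definition prime_submodule (P : set M) : Prop :=
  [/\ submodule P, P <> setT &
      forall (r : R) (m : M), P (r *: m) ->
        P m \/ [set r *: x | x in [set: M]] `<=` P].

Definition coprimely_structured_submodule (P : set M) : Prop :=
  prime_submodule P /\
  forall (L : Type) (N : L -> set M),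
    (forall l, submodule (N l)) ->
    (forall l, setadd (N l) P = setT) ->
    ~ (\bigcap_l N l `<=` P).

Definition coprimely_structured : Prop :=
  forall P : set M, prime_submodule P -> coprimely_structured_submodule P.

Definition Ann (m : M) : set R := [set r | r *: m = 0].

End Modules.

(* The direct product, with pointwise operations. *)
Definition dprodmod (R : pzRingType) (I : Type) (M : I -> lmodType R) :=
  forall i, M i.

Section DirectProduct.
Variables (R : pzRingType) (I : Type) (M : I -> lmodType R).
Local Notation T := (dprodmod M).

HB.instance Definition _ := gen_eqMixin T.
HB.instance Definition _ := gen_choiceMixin T.

Let zero : T := fun i => 0.
Let opp (f : T) : T := fun i => - f i.
Let add (f g : T) : T := fun i => f i + g i.
Let scale (a : R) (f : T) : T := fun i => a *: f i.

Fact dprodmod_addA : associative add.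
Proof. by move=> f g h; apply: functional_extensionality_dep => i; exact: addrA. Qed.
Fact dprodmod_addC : commutative add.
Proof. by move=> f g; apply: functional_extensionality_dep => i; exact: addrC. Qed.
Fact dprodmod_add0 : left_id zero add.
Proof. by move=> f; apply: functional_extensionality_dep => i; exact: add0r. Qed.
Fact dprodmod_addN : left_inverse zero opp add.
Proof. by move=> f; apply: functional_extensionality_dep => i; exact: addNr. Qed.

HB.instance Definition _ := GRing.isZmodule.Build T
  dprodmod_addA dprodmod_addC dprodmod_add0 dprodmod_addN.

Fact dprodmod_scaleA a b (f : T) : scale a (scale b f) = scale (a * b) f.
Proof. by apply: functional_extensionality_dep => i; exact: scalerA. Qed.
Fact dprodmod_scale1 : left_id 1 scale.
Proof. by move=> f; apply: functional_extensionality_dep => i; exact: scale1r. Qed.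
Fact dprodmod_scaleDr : right_distributive scale +%R.
Proof. by move=> a f g; apply: functional_extensionality_dep => i; exact: scalerDr. Qed.
Fact dprodmod_scaleDl (f : T) : {morph scale^~ f : a b / a + b}.
Proof. by move=> a b; apply: functional_extensionality_dep => i; exact: scalerDl. Qed.

HB.instance Definition _ := GRing.Zmodule_isLmodule.Build R T
  dprodmod_scaleA dprodmod_scale1 dprodmod_scaleDr dprodmod_scaleDl.

Definition finite_support : {pred T} :=
  fun f => `[< finite_set [set i | f i != 0] >].

Fact finite_support_submod_closed : GRing.submod_closed finite_support.
Proof.
split.
  apply/asboolP; apply: (sub_finite_set _ (@finite_set0 I)) => i /=.
  by rewrite eqxx.
move=> a f g /asboolP ff /asboolP fg; apply/asboolP.
apply: (sub_finite_set _ (_ : finite_set ([set i | f i != 0] `|` [set i | g i != 0]))).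
  move=> i /=; have [fi0|] := eqVneq (f i) 0; last by left.
  by move=> h; right; apply: contraNneq h => gi0;
    rewrite -[X in X == _]/(a *: f i + g i) fi0 gi0 scaler0 addr0.
by rewrite finite_setU.
Qed.

HB.instance Definition _ := GRing.isSubmodClosed.Build R T finite_support
  finite_support_submod_closed.

End DirectProduct.

(* The direct sum is the submodule of finitely supported families of the
   direct product. *)
Record dsum (R : pzRingType) (I : Type) (M : I -> lmodType R) := Dsum {
  dsum_val : dprodmod M;
  dsum_valP : dsum_val \in finite_support (M := M) }.

Section DirectSum.
Variables (R : pzRingType) (I : Type) (M : I -> lmodType R).

HB.instance Definition _ := [isSub for @dsum_val R I M].
HB.instance Definition _ := [Choice of dsum M by <:].
HB.instance Definition _ := [SubChoice_isSubLmodule of dsum M by <:].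

Lemma dsum0E i : dsum_val (0 : dsum M) i = 0. Proof. by []. Qed.
Lemma dsumDE (f g : dsum M) i :
  dsum_val (f + g) i = dsum_val f i + dsum_val g i.
Proof. by []. Qed.
Lemma dsumZE a (f : dsum M) i : dsum_val (a *: f) i = a *: dsum_val f i.
Proof. by []. Qed.

End DirectSum.

(* Main.v *)
(* The coprimality of annihilators gives, for each x in the direct sum and each
   index i, a scalar that fixes x_i and kills the other components. Hence every
   submodule N of the direct sum contains the components of its elements, i.e.
   it is the direct sum of its traces on the M_i. A prime P misses some M_i, so
   its trace on M_i is prime; if N + P is everything, so is the sum of the
   traces on M_i, and the hypothesis on M_i provides the required element. *)

From HB Require Import structures.
Require Import Defs.
From mathcomp Require Import all_boot all_algebra all_classical.
Local Open Scope classical_set_scope.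
Local Open Scope ring_scope.

Import GRing.Theory.
Set Implicit Arguments.
Unset Strict Implicit.
Unset Printing Implicit Defensive.

Section Submodule.
Variables (R : comPzRingType) (V : lmodType R) (N : set V).
Hypothesis N_submod : submodule N.

Lemma submodule0 : N 0.
Proof. by have [N0 _] := N_submod; rewrite inE in N0. Qed.

Lemma submodule_lin a (u v : V) : N u -> N v -> N (a *: u + v).
Proof.
by have [_ Nlin] := N_submod => Nu Nv; apply/set_mem/Nlin; apply/mem_set.
Qed.

Lemma submoduleZ a (u : V) : N u -> N (a *: u).
Proof. by move=> Nu; rewrite -[_ *: _]addr0; exact: submodule_lin submodule0. Qed.

Lemma submoduleD (u v : V) : N u -> N v -> N (u + v).
Proof. by move=> Nu Nv; rewrite -[u]scale1r; exact: submodule_lin. Qed.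

End Submodule.

Lemma submodule_preimage (R : comPzRingType) (U V : lmodType R)
    (f : {linear U -> V}) (N : set V) :
  submodule N -> submodule (f @^-1` N).
Proof.
move=> NS; split; first by apply/mem_set; rewrite /= linear0; exact: submodule0.
move=> a u v /set_mem Nu /set_mem Nv; apply/mem_set.
by rewrite /= linearP; exact: submodule_lin.
Qed.

Section Injection.
Variables (R : comPzRingType) (I : Type) (M : I -> lmodType R).

(** [I] is an arbitrary type, so [i = j] is decided classically and [m] is transported along the
    resulting proof. *)
Definition single_fun i (m : M i) : dprodmod M := fun j =>
  if pselect (i = j) is left e then ecast k (M k) e m else 0.

Lemma single_funE i (m : M i) : single_fun m i = m.
Proof.
rewrite /single_fun; case: pselect => // e.
by rewrite (Prop_irrelevance e erefl).
Qed.

Lemma single_fun_neq i j (m : M i) : i <> j -> single_fun m j = 0.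
Proof. by move=> ij; rewrite /single_fun; case: pselect. Qed.

Lemma single_fun_finite i (m : M i) :
  single_fun m \in Defs.finite_support (M := M).
Proof.
apply/asboolP; apply: (sub_finite_set _ (finite_set1 i)) => j /= mj.
by apply/esym; apply: contrapT => ij; rewrite single_fun_neq ?eqxx in mj.
Qed.

Definition single i (m : M i) : dsum M := Dsum (single_fun_finite m).

Lemma singleE i (m : M i) : dsum_val (single m) i = m.
Proof. exact: single_funE. Qed.

Lemma single_neq i j (m : M i) : i <> j -> dsum_val (single m) j = 0.
Proof. exact: single_fun_neq. Qed.

Lemma dsumP (x y : dsum M) :
  (forall i, dsum_val x i = dsum_val y i) -> x = y.
Proof. by move=> xy; apply/val_inj/functional_extensionality_dep. Qed.

Lemma single_linear i : linear (@single i).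
Proof.
move=> a u v; apply: dsumP => j; rewrite dsumDE dsumZE.
have [<-|ij] := pselect (i = j); first by rewrite !singleE.
by rewrite !single_neq // scaler0 addr0.
Qed.

HB.instance Definition _ i :=
  GRing.isLinear.Build R (M i) (dsum M) *:%R (@single i) (@single_linear i).

(** Provides a list for inductions on the support; [{classic I}] supplies the decidable equality
    behind list membership. *)
Lemma support_seq (x : dsum M) :
  exists s : seq {classic I},
    forall i, dsum_val x i != 0 -> (i : {classic I}) \in s.
Proof.
have /asboolP/(@finite_seqP {classic I})[s xs] := dsum_valP x.
by exists s => i xi; have : [set` s] i by rewrite -xs.
Qed.

Lemma submodule_components (N : set (dsum M)) (x : dsum M) :
  submodule N -> (forall i, N (single (dsum_val x i))) -> N x.
Proof.
move=> NS; have [s] := support_seq x.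
elim: s x => [|k s IHs] x xs Nx.
  suff -> : x = 0 by exact: submodule0.
  by apply: dsumP => i; apply/eqP; apply: contraT => /xs.
(* Split off the component at [k]: the difference vanishes at [k] and agrees with [x] elsewhere, so
   its support lies in [s] and its components lie in [N]. *)
rewrite -[x](subrK (single (dsum_val x k))).
apply: submoduleD => //; apply: IHs => i; rewrite dsumDE -scaleN1r dsumZE;
  have [<-|ki] := pselect (k = i); rewrite ?singleE ?single_neq //.
- by rewrite scaleN1r subrr eqxx.
- rewrite scaler0 addr0 => /xs; rewrite in_cons => /orP[/eqP ik|//].
  by case: ki.
- by rewrite scaleN1r subrr linear0; exact: submodule0.
- by rewrite scaler0 addr0.
Qed.

Hypothesis M_coprime_ann : forall i j : I, i <> j ->
  forall (mi : M i) (mj : M j), setadd (Ann mi) (Ann mj) = [set: R].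

(** The scalar is a product with one factor for each listed index other than [i]; the factor for [k]
    fixes the component at [i] and kills the one at [k]. *)
Lemma scalar_isolating (x : dsum M) (i : I) :
  exists e : R, e *: x = single (dsum_val x i).
Proof.
have [s xs] := support_seq x.
suff [e [exi exs]] : exists e : R, e *: dsum_val x i = dsum_val x i /\
    forall j : {classic I}, j \in s -> i <> j -> e *: dsum_val x j = 0.
  exists e; apply: dsumP => j; rewrite dsumZE.
  have [<-|ij] := pselect (i = j); first by rewrite exi singleE.
  rewrite single_neq //; have [->|/xs js] := eqVneq (dsum_val x j) 0.
    by rewrite scaler0.
  exact: exs.
elim: s {xs} => [|k s [e [exi exs]]]; first by exists 1; rewrite scale1r.
have [ik|ik] := pselect (i = k).
  exists e; split=> // j; rewrite in_cons => /orP[/eqP ->|]; last exact: exs.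
  by rewrite ik.
have : setadd (Ann (dsum_val x i)) (Ann (dsum_val x k)) 1.
  by rewrite M_coprime_ann.
(* As [a + b = 1] and [a] kills the component at [i], [b] fixes it. By commutativity, [b * e] kills
   whatever [b] or [e] kills. *)
move=> [a /= axi [b bxk ab]]; exists (b * e); split.
  by rewrite -scalerA exi -{2}[dsum_val x i]scale1r -ab scalerDl axi add0r.
move=> j; rewrite in_cons => /orP[/eqP -> _|js ij].
  by rewrite mulrC -scalerA bxk scaler0.
by rewrite -scalerA exs // scaler0.
Qed.

Lemma submodule_component (N : set (dsum M)) (x : dsum M) i :
  submodule N -> N x -> N (single (dsum_val x i)).
Proof. by move=> NS Nx; have [e <-] := scalar_isolating x i; exact: submoduleZ. Qed.

(** Write [single m] as [n + p] and read off the component at [i]: those of [n] and [p] stay in [N]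
    and [P]. *)
Lemma setadd_single (N P : set (dsum M)) i :
  submodule N -> submodule P -> setadd N P = setT ->
  setadd (@single i @^-1` N) (@single i @^-1` P) = setT.
Proof.
move=> NS PS NP; apply/seteqP; split=> // m _.
have : setadd N P (single m) by rewrite NP.
move=> [n Nn [p Pp np]].
exists (dsum_val n i); first exact: submodule_component.
exists (dsum_val p i); first exact: submodule_component.
by rewrite -dsumDE np singleE.
Qed.

End Injection.

Lemma prime_preimage (R : comPzRingType) (U V : lmodType R)
    (f : {linear U -> V}) (P : set V) :
  prime_submodule P -> f @^-1` P <> setT -> prime_submodule (f @^-1` P).
Proof.
move=> [PS _ Pprime] fP; split=> //; first exact: submodule_preimage.
move=> r m; rewrite /= linearZ => /Pprime[|rV]; first by left.
by right=> _ [x _ <-]; rewrite /= linearZ; apply: rV; exists (f x).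
Qed.

Theorem theorem2p5 (R : comPzRingType) (I : Type) (M : I -> lmodType R)
    (M_coprim : forall i, coprimely_structured (M i))
    (M_coprime_ann : forall i j : I, i <> j ->
      forall (mi : M i) (mj : M j), setadd (Ann mi) (Ann mj) = [set: R]) :
  coprimely_structured (dsum M).
Proof.
move=> P Pprime; split=> // L N NS NP capP.
have [PS PT _] := Pprime.
(* Otherwise [P] would contain all components of every [x], hence every [x], and would not be
   proper. *)
have [i iP] : exists i, @single R I M i @^-1` P <> setT.
  apply: contrapT => /forallNP allP; apply: PT; apply/seteqP; split=> // x _.
  apply: submodule_components => // i.
  have /contrapT iT := allP i.
  by rewrite -[P _]/((@single R I M i @^-1` P) _) iT.
have /M_coprim[_ /(_ L (fun l => @single R I M i @^-1` N l))] :=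
  prime_preimage Pprime iP.
apply.
- by move=> l; exact: submodule_preimage.
- by move=> l; exact: setadd_single.
(* If [m] lies in all traces of the [N l], then [single m] lies in every [N l], hence in [P]; this
   contradicts the hypothesis on [M i]. *)
- by move=> m Nm; apply: capP.
Qed.
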